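(* Let $q$ be odd, let $u,v,w\in\mathbb F_q[x]$ be quadratics and let $(M_2,M_1,M_0)$ be the minors of the pair $(v,w)$. Then $$\mathfrak d(u,v,w)=-\bigl(u_0M_2-u_1M_1+u_2M_0\bigr).$$ For monic $u$ this evaluation costs two field multiplications once the bracket $U=v'w-vw'=M_2x^2+2M_1x+M_0$ (hence its minors) is known.
   Context: A quadratic is written $s=s_2x^2+s_1x+s_0$. The minors of $(v,w)$ are $M_2=v_2w_1-v_1w_2$, $M_1=v_2w_0-v_0w_2$, $M_0=v_1w_0-v_0w_1$. The coefficient determinant is $$\mathfrak d(u,v,w)=\det\begin{pmatrix} u_0 & u_1 & u_2 \\ v_0 & v_1 & v_2 \\ w_0 & w_1 & w_2 \end{pmatrix}$$ (columns in ascending degree; for monic quadratics the last column is all ones). In the cost model, additions, subtractions, negations and multiplications by fixed constants are free. *)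

(* Defs.v *)
From mathcomp Require Import all_boot all_order all_algebra.

Set Implicit Arguments.
Unset Strict Implicit.
Unset Printing Implicit Defensive.

Import GRing.Theory.
Local Open Scope ring_scope.

Section Quadratics.
Variable F : fieldType.
Implicit Types u v w : {poly F}.

(* [size s <= 3]: the leading coefficient s`_2 is allowed to vanish. *)
Definition quadratic (s : {poly F}) : bool := (size s <= 3)%N.

Definition monic_quadratic (s : {poly F}) : bool :=
  (size s == 3) && (s \is monic).

Definition minor2 v w : F := v`_2 * w`_1 - v`_1 * w`_2.
Definition minor1 v w : F := v`_2 * w`_0 - v`_0 * w`_2.
Definition minor0 v w : F := v`_1 * w`_0 - v`_0 * w`_1.

Definition bracket v w : {poly F} := v^`() * w - v * w^`().

Definition coef_det u v w : F :=
  \det (\matrix_(i < 3, j < 3) (tnth [tuple u; v; w] i)`_j).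

End Quadratics.

(* Division-free evaluation schemes over [F] with inputs indexed by [V].
   A scheme is independent of the values of its inputs, so the scalars that
   occur in it under [Cst] are exactly the fixed constants. *)
Inductive scheme (F V : Type) : Type :=
| Var of V
| Cst of F
| Opp of scheme F V
| Add of scheme F V & scheme F V
| Sub of scheme F V & scheme F V
| Mul of scheme F V & scheme F V.

Arguments Var {F V} _.
Arguments Cst {F V} _.

Section Schemes.
Variables (F : fieldType) (V : Type).
Implicit Type e : scheme F V.

Fixpoint eval (rho : V -> F) e : F :=
  match e with
  | Var x => rho x
  | Cst c => c
  | Opp a => - eval rho a
  | Add a b => eval rho a + eval rho b
  | Sub a b => eval rho a - eval rho b
  | Mul a b => eval rho a * eval rho b
  end.

Definition is_cst e : bool := if e is Cst _ then true else false.

(* Only products of two non-constant operands are charged. *)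
Fixpoint cost e : nat :=
  match e with
  | Var _ | Cst _ => 0
  | Opp a => cost a
  | Add a b | Sub a b => cost a + cost b
  | Mul a b => cost a + cost b + ~~ (is_cst a || is_cst b)
  end.

Definition det_scheme (u0 u1 u2 m2 m1 m0 : scheme F V) : scheme F V :=
  Opp (Add (Sub (Mul u0 m2) (Mul u1 m1)) (Mul u2 m0)).

End Schemes.

Inductive input : Type :=
| UCoef of nat
| BracketCoef of nat.

Section KnownBracket.
Variable F : fieldType.

Definition inputs (u U : {poly F}) (x : input) : F :=
  match x with
  | UCoef i => u`_i
  | BracketCoef i => U`_i
  end.

(* The coefficients of the bracket are M_2, 2 M_1, M_0; halving is a
   multiplication by a fixed constant, meaningful in odd characteristic. *)
Definition minor2_scheme : scheme F input := Var (BracketCoef 2).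
Definition minor1_scheme : scheme F input :=
  Mul (Cst 2%:R^-1) (Var (BracketCoef 1)).
Definition minor0_scheme : scheme F input := Var (BracketCoef 0).

(* For monic u the coefficient u_2 is the constant 1, not an input. *)
Definition monic_det_scheme : scheme F input :=
  det_scheme (Var (UCoef 0)) (Var (UCoef 1)) (Cst 1)
             minor2_scheme minor1_scheme minor0_scheme.

End KnownBracket.

Arguments minor2_scheme {F}.
Arguments minor1_scheme {F}.
Arguments minor0_scheme {F}.
Arguments monic_det_scheme {F}.

(* Main.v *)
Require Import Defs.
From mathcomp Require Import all_boot all_order all_algebra.
From mathcomp Require Import fingroup cyclic ring.

(** The minors of [(v, w)] are, up to sign, the cofactors of the first row of
    the coefficient matrix, so the formula for the determinant is its Laplace
    expansion along that row ([coef_det_minors]).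

    The bracket [v' w - v w'] has degree at most 2, because the products of the
    leading terms cancel, and its coefficients are [M_2], [2 M_1] and [M_0]
    ([bracket_minors]). Knowing the bracket thus gives [M_2] and [M_0] outright,
    and [M_1] after a free multiplication by the constant [1/2]. That constant
    exists because a finite field with an odd number of elements cannot have
    [2 = 0] ([odd_card_natr2_neq0]).

    When [u] is monic, the term [u_2 M_0] is a multiplication by the constant 1,
    and the two products [u_0 M_2] and [u_1 M_1] are the whole cost. *)

Set Implicit Arguments.
Unset Strict Implicit.
Unset Printing Implicit Defensive.

Import GRing.Theory.
Local Open Scope ring_scope.

(** Lagrange's theorem in the additive group of [R]: the order of the element 1
    divides the number of elements. *)
Lemma natr_card_finRing (R : finNzRingType) : #|R|%:R = 0 :> R.
Proof. by have := expg_cardG (in_setT (1 : R)); rewrite FinRing.zmodXgE cardsT. Qed.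

(** If 2 vanished, the image in [R] of the odd number [#|R|] would be 1, whereas
    it is 0. *)
Lemma odd_card_natr2_neq0 (R : finNzRingType) : odd #|R| -> 2%:R != 0 :> R.
Proof.
move=> odd_R; apply/eqP => two0.
have := natr_card_finRing R.
rewrite -(odd_double_half #|R|) odd_R natrD -mul2n natrM two0 mul0r addr0.
exact/eqP/oner_neq0.
Qed.

Section Quadratics.
Variable F : fieldType.
Implicit Types u v w : {poly F}.

(** Turns statements about quadratics into identities that [ring] can decide. *)
Lemma quadraticE v :
  quadratic v -> v = (v`_2)%:P * 'X^2 + (v`_1)%:P * 'X + (v`_0)%:P.
Proof.
move=> size_v; apply/polyP=> i; rewrite !coefE.
case: i => [|[|[|i]]] /=; rewrite ?mulr0 ?mulr1 ?addr0 ?add0r //.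
by rewrite nth_default //; apply: leq_trans size_v _.
Qed.

(** The overall sign comes from the order of the degrees: the columns of the
    matrix ascend, while the minors list the higher degree first. *)
Lemma coef_det_minors u v w :
  coef_det u v w =
    - (u`_0 * minor2 v w - u`_1 * minor1 v w + u`_2 * minor0 v w).
Proof.
rewrite /coef_det (expand_det_row _ ord0) !big_ord_recl big_ord0 /cofactor.
rewrite !(expand_det_row _ ord0) !big_ord_recl !big_ord0 /cofactor !det_mx11.
rewrite !mxE /= !(tnth_nth 0) /= /minor2 /minor1 /minor0.
ring.
Qed.

(** The two contributions [2 v_2 w_2] to the cubic coefficient cancel, and so do
    the two contributions [v_1 w_1] to the linear one. *)
Lemma bracket_minors v w : quadratic v -> quadratic w ->
  bracket v w =
    minor2 v w *: 'X^2 + (2%:R * minor1 v w) *: 'X + (minor0 v w)%:P.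
Proof.
move=> /quadraticE Ev /quadraticE Ew.
rewrite /bracket {1 2}Ev {1 2}Ew !derivE -!mul_polyC.
rewrite /minor2 /minor1 /minor0.
ring.
Qed.

Lemma coef_bracket v w : quadratic v -> quadratic w ->
  [/\ (bracket v w)`_2 = minor2 v w,
      (bracket v w)`_1 = 2%:R * minor1 v w
    & (bracket v w)`_0 = minor0 v w].
Proof.
move=> qv qw; rewrite bracket_minors // !coefE /=.
by split; rewrite ?mulr0 ?mulr1 ?addr0 ?add0r.
Qed.

(** The nonvanishing of 2 is what lets [M_1] be recovered from [2 M_1]. *)
Lemma eval_minor_schemes u v w :
  2%:R != 0 :> F -> quadratic v -> quadratic w ->
  let rho := inputs u (bracket v w) in
  [/\ eval rho minor2_scheme = minor2 v w,
      eval rho minor1_scheme = minor1 v w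
    & eval rho minor0_scheme = minor0 v w].
Proof.
move=> two_neq0 qv qw /=.
by have [-> -> ->] := coef_bracket qv qw; rewrite mulKf.
Qed.

Lemma monic_quadratic_coef2 u : monic_quadratic u -> u`_2 = 1.
Proof. by case/andP=> /eqP size_u /monicP; rewrite lead_coefE size_u. Qed.

Lemma eval_monic_det_scheme u v w :
  2%:R != 0 :> F -> monic_quadratic u -> quadratic v -> quadratic w ->
  eval (inputs u (bracket v w)) monic_det_scheme = coef_det u v w.
Proof.
move=> two_neq0 mu qv qw.
have [E2 E1 E0] := eval_minor_schemes u two_neq0 qv qw.
by rewrite coef_det_minors (monic_quadratic_coef2 mu) -E2 -E1 -E0.
Qed.

End Quadratics.

Theorem proposition4p1 (F : finFieldType) (q : nat)
    (card_F : #|F| = q) (odd_q : odd q) :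
  [/\
      forall u v w : {poly F}, quadratic u -> quadratic v -> quadratic w ->
        coef_det u v w =
          - (u`_0 * minor2 v w - u`_1 * minor1 v w + u`_2 * minor0 v w),
      (forall v w : {poly F}, quadratic v -> quadratic w ->
        bracket v w =
          minor2 v w *: 'X^2 + (2%:R * minor1 v w) *: 'X + (minor0 v w)%:P) /\
      [/\ cost (@minor2_scheme F) = 0%N,
          cost (@minor1_scheme F) = 0%N,
          cost (@minor0_scheme F) = 0%N
        & forall u v w : {poly F}, quadratic v -> quadratic w ->
            let rho := inputs u (bracket v w) in
            [/\ eval rho minor2_scheme = minor2 v w,
                eval rho minor1_scheme = minor1 v w
              & eval rho minor0_scheme = minor0 v w]]
    &
      cost (@monic_det_scheme F) = 2%N /\
      forall u v w : {poly F},
        monic_quadratic u -> quadratic v -> quadratic w ->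
        eval (inputs u (bracket v w)) monic_det_scheme = coef_det u v w].
Proof.
have two_neq0 : 2%:R != 0 :> F by apply: odd_card_natr2_neq0; rewrite card_F.
split.
- by move=> u v w _ _ _; apply: coef_det_minors.
- split; first exact: bracket_minors.
  by split=> // u v w; apply: eval_minor_schemes.
- by split=> // u v w; apply: eval_monic_det_scheme.
Qed.
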